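(* Let $B\ge 2$ and $\Delta\ge 2$ be integers. Then the family of connected graphs of maximum degree at most $\Delta$ is $\left(B,\frac{1}{\Delta-1}\cdot\frac{B-1}{B}\right)$-partitionable.
   Context: All graphs are finite. A contiguous $q$-partition of a graph $G$ is a partition of $V(G)$ into $q$ (not necessarily nonempty) pieces (classes), each inducing a connected subgraph of $G$; it is $B$-bounded if every piece has size $\le B$. Two partitions agree except on a vertex set $W$ if their classes can be labelled so that each vertex outside $W$ has the same label in both. A family $\mathcal{G}$ of graphs is $(B,\alpha)$-partitionable if for every $\varepsilon>0$ there are $K$ and $\delta>0$ such that for every sufficiently large $G\in\mathcal{G}$, with $n=|V(G)|$, and every integer $q>(1+\varepsilon)n/(\alpha B)$: (1) there is a polynomial time algorithm to find a $B$-bounded contiguous $q$-partition of $G$; and (2) for any $B$-bounded contiguous partition $\omega$ of $G$ with exactly $q$ nonempty classes, there are at least $\delta|V(G)|$ distinct $B$-bounded contiguous partitions $\omega_i$ of $G$, each using fewer than $q$ nonempty classes, and each agreeing with $\omega$ except on (the vertex set of) a connected subgraph $H_i$ of $G$ with at most $K$ vertices. *)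

(* Defs.v *)
From mathcomp Require Import all_boot all_order all_algebra reals.

Set Implicit Arguments.
Unset Strict Implicit.
Unset Printing Implicit Defensive.

Import Order.TTheory GRing.Theory Num.Theory.

Record sgraph := SGraph {
  vertex :> finType;
  edge : rel vertex;
  edge_sym : symmetric edge;
  edge_irrefl : irreflexive edge }.

Section Graphs.
Variable G : sgraph.

(* [connected_in A]: the subgraph induced by [A] is connected.  The empty set
   counts as connected, since the pieces of a q-partition may be empty. *)
Definition connected_in (A : {set G}) : Prop :=
  {in A &, forall x y, connect [rel u v in A | edge u v] x y}.

Definition degree (x : G) : nat := #|[set y | edge x y]|.
Definition max_degree : nat := \max_(x : G) degree x.

(* A partition into q possibly empty pieces is given by its labelling. *)
Definition piece (q : nat) (f : G -> 'I_q) (i : 'I_q) : {set G} :=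
  [set v | f v == i].

Definition bounded_contiguous_qpartition (B q : nat) (f : G -> 'I_q) : Prop :=
  forall i, connected_in (piece f i) /\ #|piece f i| <= B.

(* An unlabelled partition is given by the set of its nonempty classes. *)
Definition bounded_contiguous_partition (B : nat) (P : {set {set G}}) : Prop :=
  partition P [set: G] /\ {in P, forall A, connected_in A /\ #|A| <= B}.

Definition agree_except (W : {set G}) (P Q : {set {set G}}) : Prop :=
  exists lP lQ : {set G} -> nat,
    [/\ {in P &, injective lP}, {in Q &, injective lQ}
      & forall v, v \notin W -> lP (pblock P v) = lQ (pblock Q v)].

End Graphs.

(* Polynomial time is measured on a unit-cost random access machine: a program
   uses finitely many unbounded arrays of natural numbers, named by literals
   and addressed by computed indices.  Every operation costs one step.  The
   only arithmetic is addition and truncated subtraction; with unit-cost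
   multiplication, numbers of exponential length could be built in linearly
   many steps, and polynomial time would differ from that of Turing machines. *)
Inductive expr :=
| Lit of nat
| Read of nat & expr
| Add of expr & expr
| Sub of expr & expr.

Inductive cmd :=
| Skip
| Write of nat & expr & expr
| Seq of cmd & cmd
| If of expr & cmd & cmd
| While of expr & cmd.

Definition store := nat -> nat -> nat.

Fixpoint eval (s : store) (e : expr) : nat :=
  match e with
  | Lit k => k
  | Read a e1 => s a (eval s e1)
  | Add e1 e2 => eval s e1 + eval s e2
  | Sub e1 e2 => eval s e1 - eval s e2
  end.

Fixpoint cost (e : expr) : nat :=
  match e with
  | Lit _ => 1
  | Read _ e1 => (cost e1).+1
  | Add e1 e2 | Sub e1 e2 => (cost e1 + cost e2).+1
  end.

Definition update (s : store) (a i x : nat) : store :=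
  fun b j => if (b == a) && (j == i) then x else s b j.

(* [exec c s t s']: started in [s], the program [c] halts in [s'] after [t]
   steps.  A test succeeds when its value is nonzero. *)
Inductive exec : cmd -> store -> nat -> store -> Prop :=
| exec_skip s : exec Skip s 1 s
| exec_write a e1 e2 s :
    exec (Write a e1 e2) s (cost e1 + cost e2).+1
         (update s a (eval s e1) (eval s e2))
| exec_seq c1 c2 s s1 s2 t1 t2 :
    exec c1 s t1 s1 -> exec c2 s1 t2 s2 -> exec (Seq c1 c2) s (t1 + t2) s2
| exec_if e c1 c2 s s' t :
    exec (if eval s e != 0 then c1 else c2) s t s' ->
    exec (If e c1 c2) s (cost e + t).+1 s'
| exec_while_end e c s :
    eval s e = 0 -> exec (While e c) s (cost e).+1 s
| exec_while_step e c s s1 s2 t1 t2 :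
    eval s e != 0 -> exec c s t1 s1 -> exec (While e c) s1 t2 s2 ->
    exec (While e c) s (cost e + t1 + t2).+1 s2.

(* Cell 0 of arrays 0 and 1 holds the order of the graph and the number q;
   array 2 holds the adjacency matrix in row-major order; every other cell is
   0.  The labels of the vertices are left in array 3. *)
Definition input (G : sgraph) (q : nat) : store := fun a i =>
  match a, i with
  | 0, 0 => #|G|
  | 1, 0 => q
  | 2, _ => nth 0 [seq nat_of_bool (edge u v) | u <- enum G, v <- enum G] i
  | _, _ => 0
  end.

Definition output (G : sgraph) (q : nat) (s : store) (f : G -> 'I_q) : Prop :=
  forall v, s 3 (enum_rank v) = f v.

(* One program solves all instances in [dom]; nothing is required of it on
   other inputs.  The number of steps does not depend on q. *)
Definition polytime_findable (dom : sgraph -> nat -> Prop)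
    (sol : forall (G : sgraph) (q : nat), (G -> 'I_q) -> Prop) : Prop :=
  exists (c : cmd) (C d : nat), forall (G : sgraph) (q : nat), dom G q ->
    exists (t : nat) (s : store) (f : G -> 'I_q),
      [/\ exec c (input G q) t s, t <= C * #|G|.+1 ^ d,
          output s f & sol G q f].

Local Open Scope ring_scope.

Definition partitionable (R : realType) (F : sgraph -> Prop)
    (B : nat) (alpha : R) : Prop :=
  forall eps : R, 0 < eps ->
  exists (K : nat) (delta : R), 0 < delta /\ exists n0 : nat,
  let admissible (G : sgraph) (q : nat) : Prop :=
    [/\ F G, (n0 <= #|G|)%N
      & (1 + eps) * #|G|%:R / (alpha * B%:R) < q%:R] in
  polytime_findable admissible
    (fun G q f => bounded_contiguous_qpartition B f) /\
  forall (G : sgraph) (q : nat), admissible G q ->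
  forall P : {set {set G}}, bounded_contiguous_partition B P -> #|P| = q ->
  exists Omega : {set {set {set G}}},
    delta * #|G|%:R <= #|Omega|%:R /\
    {in Omega, forall Q : {set {set G}},
      [/\ bounded_contiguous_partition B Q, (#|Q| < q)%N
        & exists W : {set G},
            [/\ connected_in W, (#|W| <= K)%N & agree_except W P Q]]}.

Definition connected_max_degree_le (Delta : nat) (G : sgraph) : Prop :=
  connected_in [set: G] /\ (max_degree G <= Delta)%N.

(* Main.v *)
Require Import Defs.
From mathcomp Require Import all_boot all_order all_algebra reals zify ring lra.

Set Implicit Arguments.
Unset Strict Implicit.
Unset Printing Implicit Defensive.

(* Let m = (B - 1) %/ (Delta - 1).  Search a connected graph from a root and
   treat the vertices in reverse order: merge the class of a vertex into that
   of its parent, unless it already has more than m elements or the union would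
   have more than B; in that case the class is finished.  A non-root vertex has
   at most Delta - 1 children, each contributing at most m elements, and
   (Delta - 1) m + 1 <= B, so only children of the root, or the root itself,
   can finish a class with at most m elements.  This gives at most
   n / (m + 1) + Delta + 1 classes, and n / (m + 1) <= n (Delta - 1) / (B - 1).

   For the local changes of a partition P with many classes, the same result,
   applied to the quotient graph G / P with a large bound on the size of the
   classes, groups P into few clusters of bounded size with connected unions.
   Repartitioning the union of one cluster by the same result again lowers the
   number of classes whenever the average class size in the cluster is small
   and the cluster is not too small.  By averaging, linearly many clusters have
   this property; clusters are disjoint, so the resulting partitions differ. *)

(** * Running times and total correctness *)

Fixpoint time_bound (n : nat) (c : cmd) : nat :=
  match c with
  | Skip => 1
  | Write _ e1 e2 => (cost e1 + cost e2).+1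
  | Seq c1 c2 => time_bound n c1 + time_bound n c2
  | If e c1 c2 => (cost e + (time_bound n c1 + time_bound n c2)).+1
  | While e c => n * (cost e + time_bound n c).+1 + (cost e).+1
  end.

Fixpoint loop_depth (c : cmd) : nat :=
  match c with
  | Skip | Write _ _ _ => 0
  | Seq c1 c2 | If _ c1 c2 => maxn (loop_depth c1) (loop_depth c2)
  | While _ c => (loop_depth c).+1
  end.

(** Each level of nesting costs one factor [n.+1]. With base [n.+1] instead of [n], powers are
    positive and monotone in the exponent, which absorbs lower-order terms. *)
Lemma time_bound_poly c :
  exists C, forall n, time_bound n c <= C * n.+1 ^ loop_depth c.
Proof.
have pw n d d' : d <= d' -> n.+1 ^ d <= n.+1 ^ d' by move=> ?; exact: leq_pexp2l.
elim: c => [|a e1 e2|c1 [C1 H1] c2 [C2 H2]|e c1 [C1 H1] c2 [C2 H2]|e c [C H]] /=.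
- by exists 1 => n.
- by exists (cost e1 + cost e2).+1 => n; rewrite expn0 muln1.
- exists (C1 + C2) => n; rewrite mulnDl; apply: leq_add.
    by apply: leq_trans (H1 n) _; rewrite leq_mul2l pw ?orbT // leq_maxl.
  by apply: leq_trans (H2 n) _; rewrite leq_mul2l pw ?orbT // leq_maxr.
- exists ((cost e).+1 + (C1 + C2)) => n; rewrite -addSn mulnDl; apply: leq_add.
    by rewrite leq_pmulr ?expn_gt0.
  rewrite mulnDl; apply: leq_add.
    by apply: leq_trans (H1 n) _; rewrite leq_mul2l pw ?orbT // leq_maxl.
  by apply: leq_trans (H2 n) _; rewrite leq_mul2l pw ?orbT // leq_maxr.
- exists ((cost e).+1 + C) => n; rewrite expnS.
  have := H n; have : 0 < n.+1 ^ loop_depth c by rewrite expn_gt0.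
  move: (n.+1 ^ _) => p; nia.
Qed.

(* [n] bounds the number of iterations of every loop at each of its entries. *)
Definition runs (n : nat) (c : cmd) (s : store) (Q : store -> Prop) : Prop :=
  exists t s', [/\ exec c s t s', t <= time_bound n c & Q s'].

Lemma runs_weaken n c s (Q Q' : store -> Prop) :
  runs n c s Q -> (forall s', Q s' -> Q' s') -> runs n c s Q'.
Proof. by move=> [t [s' [e l q]]] h; exists t, s'; split=> //; exact: h. Qed.

Lemma runs_skip n s (Q : store -> Prop) : Q s -> runs n Skip s Q.
Proof. by exists 1, s; split=> //; constructor. Qed.

Lemma runs_write n a e1 e2 s (Q : store -> Prop) :
  Q (update s a (eval s e1) (eval s e2)) -> runs n (Write a e1 e2) s Q.
Proof. by move=> q; eexists _, _; split; [exact: exec_write| |]. Qed.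

Lemma runs_seq n c1 c2 s Q :
  runs n c1 s (fun s1 => runs n c2 s1 Q) -> runs n (Seq c1 c2) s Q.
Proof.
move=> [t1 [s1 [e1 l1 [t2 [s2 [e2 l2 q]]]]]].
by exists (t1 + t2), s2; split=> //=; [exact: exec_seq e1 e2 | exact: leq_add].
Qed.

Lemma runs_if n e c1 c2 s Q :
  (eval s e != 0 -> runs n c1 s Q) -> (eval s e = 0 -> runs n c2 s Q) ->
  runs n (If e c1 c2) s Q.
Proof.
move=> h1 h2; case E: (eval s e != 0).
  have [t [s' [x l q]]] := h1 E.
  exists (cost e + t).+1, s'; split=> //=; last by lia.
  by constructor; rewrite E.
have /eqP E0 := negbFE E; have [t [s' [x l q]]] := h2 E0.
exists (cost e + t).+1, s'; split=> //=; last by lia.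
by constructor; rewrite E.
Qed.

(** Every loop of the solver makes exactly [n] iterations, so the invariant is indexed by the number
    of completed ones and has to decide the loop test. *)
Lemma runs_for n e c (I : nat -> store -> Prop) s (Q : store -> Prop) :
  I 0 s ->
  (forall i s', i < n -> I i s' -> eval s' e != 0 /\ runs n c s' (I i.+1)) ->
  (forall s', I n s' -> eval s' e = 0 /\ Q s') ->
  runs n (While e c) s Q.
Proof.
move=> I0 step fin.
suff H m i s1 : i + m = n -> I i s1 ->
    exists t s', [/\ exec (While e c) s1 t s',
      t <= m * (cost e + time_bound n c).+1 + (cost e).+1 & Q s'].
  by have [t [s' [x l q]]] := H n 0 s (add0n n) I0; exists t, s'.
elim: m i s1 => [|m IH] i s1.
  rewrite addn0 => -> /fin[E q].
  by exists (cost e).+1, s1; split=> //; constructor.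
move=> Em Ii; have lt : i < n by lia.
have [E [t1 [s2 [x1 l1 i1]]]] := step i s1 lt Ii.
have [|t2 [s3 [x2 l2 q]]] := IH i.+1 s2 _ i1; first by lia.
exists (cost e + t1 + t2).+1, s3; split=> //; first exact: exec_while_step x1 x2.
by rewrite mulSn; lia.
Qed.

(* Arrays 4 and 5: loop counters; 6: the search order; 7: parents; 8: marks;
   9: number of marked vertices; 10: row offsets; 11: representatives;
   12: class sizes; 13: number of finished classes; 14: current vertex;
   15: its new representative; 16: whether its class is finished. *)
Definition cell a := Read a (Lit 0).
Definition assign a e := Write a (Lit 0) e.
Definition incr a := assign a (Add (cell a) (Lit 1)).

(** Array 10 receives the multiples of the order by repeated addition, so that the adjacency matrix
    can be addressed without multiplication. *)
Definition init_body :=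
  Seq (Write 10 (cell 4) (cell 9))
 (Seq (assign 9 (Add (cell 9) (cell 0)))
 (Seq (Write 11 (cell 4) (cell 4))
 (Seq (Write 12 (cell 4) (Lit 1))
      (incr 4)))).

Definition search_visit :=
  Seq (Write 6 (cell 9) (cell 5))
 (Seq (Write 7 (cell 5) (Read 6 (cell 4)))
 (Seq (Write 8 (cell 5) (Lit 1))
      (incr 9))).

(** On values 0 and 1, the truncated difference in the test means adjacent and not yet marked. *)
Definition search_inner :=
  Seq (If (Defs.Sub (Read 2 (Add (Read 10 (Read 6 (cell 4))) (cell 5)))
               (Read 8 (cell 5)))
          search_visit Skip)
      (incr 5).

Definition search_body :=
  Seq (assign 5 (Lit 0))
 (Seq (While (Defs.Sub (cell 0) (cell 5)) search_inner)
      (incr 4)).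

(** A sum of the two opposite truncated differences tests inequality. The label written to array 3
    is provisional: if the class is merged, it is overwritten when the enclosing class is
    finished. *)
Definition merge_inner :=
  Seq (If (Add (Defs.Sub (Read 11 (cell 5)) (cell 14))
               (Defs.Sub (cell 14) (Read 11 (cell 5))))
          Skip
          (Seq (Write 3 (cell 5) (cell 13))
               (Write 11 (cell 5) (cell 15))))
      (incr 5).

Definition size_of_current := Read 12 (cell 14).
Definition parent_of_current := Read 7 (cell 14).

(** The test is a disjunction written as a sum: the vertex is the root, its class has more than [m]
    elements, or the union with the parent's class has more than [B]. *)
Definition merge_body (B m : nat) :=
  Seq (assign 4 (Defs.Sub (cell 4) (Lit 1)))
 (Seq (assign 14 (Read 6 (cell 4)))
 (Seq (If (Add (Defs.Sub (Lit 1) (cell 4))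
          (Add (Defs.Sub size_of_current (Lit m))
               (Defs.Sub (Add size_of_current (Read 12 parent_of_current)) (Lit B))))
          (Seq (assign 15 (cell 14)) (assign 16 (Lit 1)))
          (Seq (assign 15 parent_of_current)
          (Seq (assign 16 (Lit 0))
               (Write 12 (cell 15) (Add (Read 12 (cell 15)) size_of_current)))))
 (Seq (assign 5 (Lit 0))
 (Seq (While (Defs.Sub (cell 0) (cell 5)) merge_inner)
      (assign 13 (Add (cell 13) (cell 16))))))).

Definition search :=
  Seq (assign 4 (Lit 0))
 (Seq (assign 9 (Lit 1))
 (Seq (Write 8 (Lit 0) (Lit 1))
      (While (Defs.Sub (cell 0) (cell 4)) search_body))).

Definition solver (B m : nat) :=
  Seq (While (Defs.Sub (cell 0) (cell 4)) init_body)
 (Seq search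
      (While (cell 4) (merge_body B m))).

(** * Search orders and merging along parents *)

Lemma homo_connect (T T' : finType) (e : rel T) (e' : rel T') (h : T -> T') :
  (forall x y, e x y -> connect e' (h x) (h y)) ->
  forall x y, connect e x y -> connect e' (h x) (h y).
Proof.
move=> he x y /connectP[p]; elim: p x => [|z p IH] x /= => [_ ->//|].
by case/andP=> /he xz pz ly; apply: connect_trans xz (IH _ pz ly).
Qed.

Section Connected.
Variable G : sgraph.
Implicit Types (A B : {set G}) (x y : G).

Lemma connected_in_subset A B x y : A \subset B ->
  connect [rel u v in A | edge u v] x y -> connect [rel u v in B | edge u v] x y.
Proof.
move=> AB; apply: (homo_connect (h := id)) => u v /= /andP[/andP[uA vA] uv].
by apply: connect1 => /=; rewrite !(subsetP AB) // uv.
Qed.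

Lemma connected_in1 x : connected_in [set x].
Proof. by move=> u v /set1P-> /set1P->; exact: connect0. Qed.

Lemma connected_inU A B x y :
  connected_in A -> connected_in B -> x \in A -> y \in B -> edge x y ->
  connected_in (A :|: B).
Proof.
move=> cA cB xA yB xy.
set e := [rel u v in A :|: B | edge u v].
have esym : connect_sym e.
  by apply: sym_connect_sym => u v /=; rewrite [edge v u]edge_sym [(v \in _) && _]andbC.
have toA u : u \in A -> connect e u x.
  by move=> uA; apply: connected_in_subset (cA _ _ uA xA); exact: subsetUl.
have toB u : u \in B -> connect e u y.
  by move=> uB; apply: connected_in_subset (cB _ _ uB yB); exact: subsetUr.
have exy : connect e x y by apply: connect1; rewrite /= !inE xA yB orbT.
have to u : u \in A :|: B -> connect e u y.
  by case/setUP=> [/toA ux | /toB//]; exact: connect_trans ux exy.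
by move=> u v /to uy /to vy; apply: connect_trans uy _; rewrite esym.
Qed.

End Connected.

Section SearchOrder.
Variables (G : sgraph) (v0 : G).
Implicit Types (o : seq G) (par : G -> G).

(** Here [o] is the queue of discovered vertices, the first [i] of which have been scanned
    completely. *)
Record search_inv (i : nat) o par : Prop := SearchInv {
  si_uniq : uniq o;
  si_start : ohead o = Some v0;
  si_le : i <= size o;
  si_par : forall x, x \in o -> x != v0 ->
    edge x (par x) /\ index (par x) o < index x o;
  si_closed : forall x y, x \in take i o -> edge x y -> y \in o }.

Lemma search_inv0 par : search_inv 0 [:: v0] par.
Proof. by split=> // x; rewrite inE => ->. Qed.

Lemma search_mem i o par : search_inv i o par -> v0 \in o.
Proof. by move=> /si_start; case: o => //= x o [->]; rewrite inE eqxx. Qed.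

Lemma search_inv_visit i o par x u :
  search_inv i o par -> x \in o -> u \notin o -> edge x u ->
  search_inv i (rcons o u) (fun y => if y == u then x else par y).
Proof.
move=> [Uo So Lo Po Co] xo uo xu; split.
- by rewrite rcons_uniq uo.
- by case: o So {Uo Lo Po Co xo uo} => //.
- by rewrite size_rcons leqW.
- move=> y; rewrite mem_rcons inE -!cats1 !index_cat => /orP[/eqP-> _|yo yv].
    by rewrite eqxx edge_sym xo (negPf uo) /= eqxx addn0 index_mem.
  have [ey iy] := Po y yo yv.
  have py : par y \in o by rewrite -index_mem (ltn_trans iy) // index_mem.
  case: eqP yo uo => [->|_] yo; first by rewrite yo.
  by rewrite yo py.
- move=> y z yo yz; rewrite mem_rcons inE (Co y z) ?orbT //.
  by move: yo; rewrite -cats1 takel_cat.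
Qed.

Lemma search_inv_next i o par :
  search_inv i o par -> i < size o ->
  (forall y, edge (nth v0 o i) y -> y \in o) -> search_inv i.+1 o par.
Proof.
move=> [Uo So Lo Po Co] lt cl; split=> // x y.
by rewrite (take_nth v0 lt) mem_rcons inE => /orP[/eqP-> | xo]; [exact: cl | exact: Co].
Qed.

Hypothesis conn : connected_in [set: G].

(** Once the whole queue is scanned, it is closed under adjacency and contains [v0], so
    connectedness makes it everything. *)
Lemma search_complete i o par :
  search_inv i o par -> i = size o -> forall x, x \in o.
Proof.
move=> inv E x; have So := search_mem inv.
have Co := si_closed inv; rewrite E take_size in Co.
have /connectP[p] := conn (in_setT v0) (in_setT x).
elim: p (v0) So => [|z p IH] y yo /= => [_ ->//|].
by case/andP=> /andP[_ yz]; apply: IH; exact: Co yz.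
Qed.

Lemma search_size o : uniq o -> (forall x, x \in o) -> size o = #|G|.
Proof. by move=> Uo all; rewrite -(card_uniqP Uo); apply: eq_card => x; rewrite all. Qed.

(** The queue cannot run empty early: an exhausted queue contains all vertices, so [i] would already
    be the order of [G]. *)
Lemma search_progress i o par : search_inv i o par -> i < #|G| -> i < size o.
Proof.
move=> inv lt; have := si_le inv; rewrite leq_eqVlt => /orP[/eqP E|//].
by rewrite E (search_size (si_uniq inv) (search_complete inv E)) ltnn in lt.
Qed.

End SearchOrder.

(** * Invariants of merging along parents, and the count of finished classes *)

Section Merging.
Variables (G : sgraph) (v0 : G) (o : seq G) (par : G -> G) (B Delta m : nat).
Hypotheses (Uo : uniq o) (starto : ohead o = Some v0) (allo : forall x, x \in o)
  (parP : forall x, x != v0 -> edge x (par x) /\ index (par x) o < index x o)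
  (deg : max_degree G <= Delta) (Delta2 : 2 <= Delta)
  (mB : m * (Delta - 1) < B).

(** Vertices are treated from the end of the order towards the root, so these are the children
    already treated when position [t] is reached. *)
Definition children t x : {set G} :=
  [set y : G | [&& edge x y, t <= index y o & par y == x]].

(* Representatives at positions [>= t] of the order belong to finished classes;
   the exceptional finished classes, counted by [j], may have at most [m] elements. *)
Record merge_inv (t : nat) (rep : G -> G) (lab : G -> nat) (k : nat) : Prop := MergeInv {
  mi_conn : forall x, connected_in [set v | rep v == x];
  mi_size : forall x, #|[set v | rep v == x]| <= B;
  mi_self : forall x, index x o < t -> rep x = x;
  mi_lab_lt : forall v, t <= index (rep v) o -> lab v < k;
  mi_lab_inj : forall v w, t <= index (rep v) o -> t <= index (rep w) o ->
    (lab v == lab w) = (rep v == rep w);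
  mi_small : forall x, index x o < t ->
    #|[set v | rep v == x]| <= 1 + m * #|children t x|;
  mi_count : exists j,
    j <= #|[set y : G | edge v0 y & t <= index y o]| + (t == 0) /\
    m.+1 * k <= m.+1 * j + #|[set v | t <= index (rep v) o]| }.

Lemma index_inj x y : index x o = index y o -> x = y.
Proof. by move=> E; rewrite -(nth_index x (allo x)) E nth_index. Qed.

Lemma degree_le x : #|[set y : G | edge x y]| <= Delta.
Proof. by apply: leq_trans deg; exact: (leq_bigmax x). Qed.

Lemma merge_inv0 lab : merge_inv #|G| id lab 0.
Proof.
have lt x : index x o < #|G| by rewrite -(search_size Uo allo) index_mem.
have fib x : [set v | v == x] = [set x] by apply/setP=> v; rewrite !inE.
split=> //.
- by move=> x; rewrite fib; exact: connected_in1.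
- by move=> x; rewrite fib cards1; exact: leq_ltn_trans mB.
- by move=> v; rewrite leqNgt lt.
- by move=> v w; rewrite leqNgt lt.
- by move=> x _; rewrite fib cards1.
- by exists 0; rewrite !muln0.
Qed.

Lemma childrenS t x : children t.+1 x \subset children t x.
Proof. by apply/subsetP=> y; rewrite !inE => /and3P[-> /ltnW-> ->]. Qed.

Section Step.
Variables (t : nat) (u : G) (rep : G -> G) (lab : G -> nat) (k : nat).
Hypotheses (inv : merge_inv t.+1 rep lab k) (ut : index u o = t).

Let lab' v := if rep v == u then k else lab v.

(** Neither [u] nor the grandparent is a treated child of [par u], so [par u] has at most
    [Delta - 2] treated children. If the class of [u] has at most [m] elements, the union has at
    most [1 + m * (Delta - 1)], hence at most [B]. *)
Lemma unfinished_parent : u != v0 -> par u != v0 ->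
  m < #|[set v | rep v == u]| \/
  #|[set v | rep v == u]| + #|[set v | rep v == par u]| <= B.
Proof.
move=> uv pv; case: (ltnP m #|[set v | rep v == u]|) => [|small]; [by left | right].
have [eu iu] := parP uv; have [ep ip] := parP pv; rewrite ut in iu.
have lt : index (par u) o < t.+1 by rewrite leqW.
have := mi_small inv lt.
have : #|children t.+1 (par u)| + 2 <= Delta.
  apply: leq_trans (degree_le (par u)).
  have ne : u != par (par u).
    by apply/eqP=> E; move: ip; rewrite -E ut; move: iu; lia.
  have -> : 2 = #|[set u; par (par u)]| by rewrite cards2 ne.
  rewrite -cardsUI (_ : _ :&: _ = set0) ?cards0 ?addn0.
    apply: subset_leq_card; apply/subsetP=> y; rewrite !inE.
    case/orP=> [/and3P[]//|/orP[]/eqP->//]; by rewrite edge_sym.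
  apply/setP=> y; rewrite !inE; apply/negP=> /andP[/and3P[_ iy _] /orP[]/eqP E].
    by rewrite E ut ltnn in iy.
  by rewrite E in iy; move: iy ip iu; lia.
move: small mB Delta2; move: #|_| #|_| #|_| => a b c; nia.
Qed.

(** A finished class with more than [m] elements pays for itself in the count. A smaller one raises
    [j] by one, charged either to [t = 0] or to [u] as a newly counted neighbour of [v0]. *)
Lemma merge_inv_cut :
  t = 0 \/ m < #|[set v | rep v == u]| \/
    B < #|[set v | rep v == u]| + #|[set v | rep v == par u]| ->
  merge_inv t rep lab' k.+1.
Proof.
move=> cut; case: (inv) => C S F L I M [j [j1 j2]].
have iE v : (t <= index (rep v) o) = (rep v == u) || (t < index (rep v) o).
  rewrite leq_eqVlt; congr (_ || _); apply/eqP/eqP=> [|->//].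
  by rewrite -ut => /index_inj.
split=> //.
- by move=> x lt; apply: F; exact: leqW.
- move=> v; rewrite iE /lab' => /orP[->//|/L lt].
  by case: ifP => // _; exact: leqW.
- move=> v w; rewrite !iE /lab'.
  case: eqP => [Ev|nv] /=; case: eqP => [Ew|nw] //=.
  + by rewrite Ev Ew !eqxx.
  + move=> _ /L lt; rewrite Ev [u == _]eq_sym; move/eqP/negPf: nw => ->.
    by apply/eqP; lia.
  + move=> /L lt _; rewrite Ew; move/eqP/negPf: nv => ->.
    by apply/eqP; lia.
  + exact: I.
- move=> x lt; apply: leq_trans (M x (leqW lt)) _.
  by rewrite leq_add2l leq_mul2l subset_leq_card ?orbT ?childrenS.
have fin : #|[set v | t <= index (rep v) o]| =
    #|[set v | rep v == u]| + #|[set v | t < index (rep v) o]|.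
  rewrite -cardsUI (_ : _ :&: _ = set0) ?cards0 ?addn0.
    by apply: eq_card => v; rewrite !inE iE.
  apply/setP=> v; rewrite !inE; apply/negP=> /andP[/eqP->]; by rewrite ut ltnn.
have nb : #|[set y : G | edge v0 y & t < index y o]| <= #|[set y : G | edge v0 y & t <= index y o]|.
  by apply: subset_leq_card; apply/subsetP=> y; rewrite !inE => /andP[-> /ltnW].
rewrite addn0 in j1.
have [big|small] := ltnP m #|[set v | rep v == u]|.
  by exists j; rewrite fin; split; [lia | nia].
have [t0|tn0] := eqVneq t 0.
  by exists j.+1; rewrite fin; split; [lia | nia].
exists j.+1; split; last by rewrite fin; nia.
rewrite addn0; apply: leq_ltn_trans j1 _; apply: proper_card.
apply/properP; split.
  by apply/subsetP=> y; rewrite !inE => /andP[-> /ltnW].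
have uv : u != v0.
  by apply: contraNneq tn0 => E; rewrite -ut E; case: (o) starto => //= x o' [->]; rewrite eqxx.
have [eu iu] := parP uv.
(* With a parent other than the root, [unfinished_parent] would contradict every alternative in
   [cut] that is left. *)
have pv : par u = v0.
  apply/eqP; apply: contraT => pv; case: (unfinished_parent uv pv) => ?; first lia.
  by case: cut => [E|[|]]; [rewrite E eqxx in tn0 | lia | lia].
by exists u; rewrite !inE ?ut ?ltnn ?andbF // leqnn -pv edge_sym eu.
Qed.

(** The vertices of the absorbed class get the label [k] here too; this is harmless, since the label
    conditions concern only finished classes. *)
Lemma merge_inv_merge :
  t <> 0 -> #|[set v | rep v == u]| <= m ->
  #|[set v | rep v == u]| + #|[set v | rep v == par u]| <= B ->
  merge_inv t (fun v => if rep v == u then par u else rep v) lab' k.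
Proof.
move=> tn0 small fits; case: (inv) => C S F L I M [j [j1 j2]].
have uv : u != v0.
  by apply/eqP=> E; case: tn0; rewrite -ut E; case: (o) starto => //= x o' [->]; rewrite eqxx.
have [eu iu] := parP uv; rewrite ut in iu.
have pu : par u != u by apply: contraTneq iu => ->; rewrite ut ltnn.
have [Fu Fp] : rep u = u /\ rep (par u) = par u by split; apply: F; lia.
set rep' := fun v => _.
have fibP : [set v | rep' v == par u] = [set v | rep v == u] :|: [set v | rep v == par u].
  apply/setP=> v; rewrite !inE /rep'; case: (rep v == u) => //=; exact: eqxx.
have fibU : [set v | rep' v == u] = set0.
  by apply/setP=> v; rewrite !inE /rep'; case: ifP => // _; exact: negPf pu.
have fib x : x != u -> x != par u -> [set v | rep' v == x] = [set v | rep v == x].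
  move=> xu xp; apply/setP=> v; rewrite !inE /rep'; case: (eqVneq (rep v) u) => // ->.
  by rewrite eq_sym (negPf xp) eq_sym (negPf xu).
have iE v : t <= index (rep' v) o -> rep v != u /\ t < index (rep v) o.
  rewrite /rep'; case: (eqVneq (rep v) u) => [_|nu]; first by lia.
  rewrite leq_eqVlt => /orP[/eqP|//]; rewrite -ut => /index_inj E.
  by rewrite E eqxx in nu.
split=> //.
- move=> x; have [->|xu] := eqVneq x u; first by rewrite fibU => ? ?; rewrite inE.
  have [->|xp] := eqVneq x (par u); last by rewrite fib.
  by rewrite fibP; apply: (@connected_inU _ _ _ u (par u)) => //; rewrite inE ?Fu ?Fp.
- move=> x; have [->|xu] := eqVneq x u; first by rewrite fibU cards0.
  have [->|xp] := eqVneq x (par u); last by rewrite fib.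
  by rewrite fibP; apply: leq_trans fits; rewrite cardsU leq_subr.
- move=> x lt; rewrite /rep' F ?ifN ?leqW //; apply: contraTneq lt => ->.
  by rewrite ut ltnn.
- by move=> v /iE[nu lt]; rewrite /lab' (negPf nu); exact: L.
- move=> v w /iE[nv lv] /iE[nw lw].
  by rewrite /lab' /rep' (negPf nv) (negPf nw); exact: I.
- move=> x lt; have [E|xp] := eqVneq x (par u); last first.
    rewrite fib //; last by apply: contraTneq lt => ->; rewrite ut ltnn.
    apply: leq_trans (M x (leqW lt)) _.
    by rewrite leq_add2l leq_mul2l subset_leq_card ?orbT ?childrenS.
  (* The class of [par u] gains at most [m] elements, while [u] becomes one more treated child. *)
  rewrite E fibP; have := M _ (leqW iu).
  have : #|children t.+1 (par u)| < #|children t (par u)|.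
    apply: proper_card; apply/properP; split; first exact: childrenS.
    by exists u; rewrite !inE ut ?ltnn ?andbF // leqnn eqxx edge_sym eu.
  have := cardsUI [set v | rep v == u] [set v | rep v == par u].
  move: small; move: #|_| #|_| #|_| #|_| #|_| #|_| => a b c d e f; nia.
- exists j; split.
    apply: leq_trans j1 _; apply: leq_add => //.
    by apply: subset_leq_card; apply/subsetP=> y; rewrite !inE => /andP[-> /ltnW].
  apply: leq_trans j2 _; rewrite leq_add2l subset_leq_card //.
  apply/subsetP=> v; rewrite !inE /rep'; case: (eqVneq (rep v) u) => [->|_ /ltnW//].
  by rewrite ut ltnn.
Qed.

End Step.

(** At [t = 0] all classes are finished, and [j] is at most the degree of [v0] plus one for the root
    itself. *)
Lemma merge_inv_end rep lab k : merge_inv 0 rep lab k ->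
  [/\ forall v, lab v < k, forall i, connected_in [set v | lab v == i],
      forall i, #|[set v | lab v == i]| <= B & m.+1 * k <= m.+1 * Delta.+1 + #|G|].
Proof.
case=> C S F L I M [j [j1 j2]].
have fib i : (exists x, [set v | lab v == i] = [set v | rep v == x]) \/
    [set v | lab v == i] = set0.
  have [E|[w wi]] := set_0Vmem [set v | lab v == i]; [by right | left].
  move: wi; rewrite inE => /eqP<-; exists (rep w); by apply/setP=> v; rewrite !inE; exact: I.
split=> [v|i|i|]; first exact: L.
- by case: (fib i) => [[x ->] //|->] ? ?; rewrite inE.
- by case: (fib i) => [[x ->] //|->]; rewrite cards0.
apply: leq_trans j2 _; apply: leq_add; last exact: max_card.
rewrite leq_pmul2l // (leq_trans j1) // eqxx addn1 ltnS.
by apply: leq_trans (degree_le v0); apply: subset_leq_card; apply/subsetP=> y; rewrite !inE => /andP[].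
Qed.

End Merging.

(** * Correctness of the program *)

(** The frame condition: [L] lists the arrays that may have been modified. *)
Definition unchanged (L : seq nat) (s s' : store) : Prop :=
  forall a i, a \notin L -> s' a i = s a i.

Lemma unchanged_update L s s' a i x :
  a \in L -> unchanged L s s' -> unchanged L s (update s' a i x).
Proof.
move=> aL h b j bL; rewrite /update; case: eqP => [E|_] /=; last exact: h.
by rewrite -E (negPf bL) in aL.
Qed.

Lemma unchanged_trans L s1 s2 s3 :
  unchanged L s1 s2 -> unchanged L s2 s3 -> unchanged L s1 s3.
Proof. by move=> h1 h2 a i aL; rewrite h2 ?h1. Qed.

Lemma unchanged_sub L L' s1 s2 :
  {subset L <= L'} -> unchanged L s1 s2 -> unchanged L' s1 s2.
Proof. by move=> LL h a i aL; apply: h; apply: contra aL; exact: LL. Qed.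

Lemma nth_allpairs (S T : Type) (f : S -> T -> nat) x0 y0 (r : seq S) (t : seq T) i j :
  i < size r -> j < size t ->
  nth 0 [seq f x y | x <- r, y <- t] (i * size t + j) = f (nth x0 r i) (nth y0 t j).
Proof.
elim: r i => [//|x r IH] [|i] /= hi hj; rewrite nth_cat size_map.
  by rewrite mul0n add0n hj (nth_map y0).
by rewrite mulSn -addnA ltnNge leq_addr /= addKn IH.
Qed.

Section Correctness.
Variables (G : sgraph) (q : nat) (v0 : G).
Hypothesis rank0 : enum_rank v0 = 0 :> nat.
Local Notation n := #|G|.
Local Notation rk v := (nat_of_ord (enum_rank v)).

Lemma rk_inj (u v : G) : rk u = rk v -> u = v.
Proof. by move=> E; apply: enum_rank_inj; exact: val_inj. Qed.

Lemma rk_eq (u v : G) : (rk u == rk v) = (u == v).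
Proof. by apply/eqP/eqP=> [/rk_inj|->]. Qed.

Lemma rk_surj i : i < n -> exists v : G, rk v = i.
Proof. by move=> lt; exists (enum_val (Ordinal lt)); rewrite enum_valK. Qed.

Lemma input_adjacency (u v : G) : input G q 2 (rk u * n + rk v) = edge u v.
Proof.
have hn (x : G) : nth v0 (enum G) (rk x) = x by exact: nth_enum_rank.
have -> : rk u * n = rk u * size (enum G) by congr (_ * _); exact: cardE.
by rewrite /= (nth_allpairs _ v0 v0) ?hn // -cardE; exact: ltn_ord.
Qed.

Definition initialized (s : store) : Prop :=
  [/\ s 0 0 = n, forall u v : G, s 2 (s 10 (rk u) + rk v) = edge u v,
      forall v : G, s 11 (rk v) = rk v, forall v : G, s 12 (rk v) = 1 &
      forall a i, a \in [:: 3; 6; 7; 8; 13] -> s a i = 0].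

Lemma init_correct :
  runs n (While (Defs.Sub (cell 0) (cell 4)) init_body) (input G q) initialized.
Proof.
pose I i (s : store) := [/\ s 4 0 = i, s 9 0 = i * n,
  forall j, j < i -> [/\ s 10 j = j * n, s 11 j = j & s 12 j = 1] &
  unchanged [:: 4; 9; 10; 11; 12] (input G q) s].
apply: (@runs_for _ _ _ I); first by split.
- move=> i s lt [s4 s9 done fr]; have s0 : s 0 0 = n by rewrite fr.
  split; first by rewrite /= s0 s4; lia.
  do 4 (apply: runs_seq; apply: runs_write); apply: runs_write.
  split; last by do 5 (apply: unchanged_update => //).
  + by rewrite /update /= s4 addn1.
  + by rewrite /update /= s9 s0 mulSn addnC.
  + move=> j; rewrite /update /= !s4 s9 ltnS leq_eqVlt.
    by case: eqP => [->|_] //= lj; exact: done.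
- move=> s [s4 s9 done fr]; have s0 : s 0 0 = n by rewrite fr.
  split; first by rewrite /= s0 s4 subnn.
  have H (v : G) : [/\ s 10 (rk v) = rk v * n, s 11 (rk v) = rk v & s 12 (rk v) = 1].
    exact: done (ltn_ord _).
  split=> // [u v|v|v|a i aL].
  + by have [-> _ _] := H u; rewrite fr // input_adjacency.
  + by have [] := H v.
  + by have [] := H v.
  + by rewrite fr; move: aL; rewrite !inE;
    do 4 (case/orP => [/eqP-> //|]); move/eqP->.
Qed.

Record search_state (s : store) (o : seq G) (par : G -> G) : Prop := SearchState {
  ss_order : forall k, k < size o -> s 6 k = rk (nth v0 o k);
  ss_parent : forall v, s 7 (rk v) = rk (par v);
  ss_mark : forall v, s 8 (rk v) = (v \in o);
  ss_size : s 9 0 = size o }.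

Hypothesis conn : connected_in [set: G].

Section Search.
Variable s0 : store.
Hypothesis ini : initialized s0.
Let L := [:: 4; 5; 6; 7; 8; 9].

Let search_loop i (s : store) := exists o par,
  [/\ s 4 0 = i, unchanged L s0 s, search_state s o par & search_inv v0 i o par].

Lemma search_body_correct i s : i < n -> search_loop i s ->
  runs n search_body s (search_loop i.+1).
Proof.
have [i0 i2 _ _ _] := ini.
move=> lt [o [par [s4 fr st inv]]].
apply: runs_seq; apply: runs_write; apply: runs_seq.
(* The queue grows during the scan, so [o] and [par] are quantified inside the invariant; new
   vertices are appended, so the vertex at position [i] stays the same. *)
pose I j (s' : store) := exists o par, [/\ s' 4 0 = i /\ s' 5 0 = j,
  unchanged L s0 s', search_state s' o par, search_inv v0 i o par &
  forall u, rk u < j -> edge (nth v0 o i) u -> u \in o].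
apply: (@runs_for _ _ _ I).
- exists o, par; split=> //; first by apply: unchanged_update.
  by case: st => h6 h7 h8 h9; split.
- move=> j s' ltj [o' [par' [[h4 h5] fr' [h6 h7 h8 h9] inv' cl]]].
  have h0 : s' 0 0 = n by rewrite fr'.
  split; first by rewrite /= h0 h5; lia.
  have [u ru] := rk_surj ltj; rewrite -{j}ru in ltj h5 cl *; have lto := search_progress conn inv' lt.
  set x := nth v0 o' i in cl; have xo : x \in o' by exact: mem_nth.
  have test : s' 2 (s' 10 (rk x) + rk u) = edge x u.
    by rewrite !fr' // i2.
  apply: runs_seq; apply: runs_if => /=; rewrite h4 h5 h6 // test h8.
  + case ex : (edge x u) => //; case uo : (u \in o') => // _.
    do 3 (apply: runs_seq; apply: runs_write); do 2 apply: runs_write.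
    exists (rcons o' u), (fun y => if y == u then x else par' y).
    have nx : nth v0 (rcons o' u) i = x by rewrite nth_rcons lto.
    split.
    * by rewrite /update /= h4 h5 addn1.
    * by do 5 (apply: unchanged_update => //).
    * rewrite /update /=; split=> [k|v|v|] /=.
      - rewrite size_rcons ltnS nth_rcons h9 h5 leq_eqVlt.
        by case: eqP => [->|_] /= lk; rewrite ?ltnn ?eqxx // lk h6.
      - by rewrite h5 h4 rk_eq h9 (ltn_eqF lto) h6 //; case: eqP.
      - by rewrite h5 rk_eq mem_rcons inE h8; case: eqP.
      - by rewrite h9 size_rcons addn1.
    * by apply: search_inv_visit => //; rewrite ?uo ?ex.
    * move=> w; rewrite nx mem_rcons inE ltnS leq_eqVlt.
      by case/orP=> [/eqP/rk_inj->|lw ew]; [rewrite eqxx | rewrite cl ?orbT].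
  + move=> no; apply: runs_skip; apply: runs_write.
    exists o', par'; split=> //.
    * by rewrite /update /= h4 h5 addn1.
    * exact: unchanged_update.
    * move=> w; rewrite ltnS leq_eqVlt => /orP[/eqP/rk_inj->|lw ew].
        by move: no; rewrite -/x; case: (edge x u) => //; case: (u \in o').
      by rewrite cl.
- move=> s' [o' [par' [[h4 h5] fr' st' inv' cl]]].
  have h0 : s' 0 0 = n by rewrite fr'.
  split; first by rewrite /= h0 h5 subnn.
  apply: runs_write; exists o', par'; split.
  + by rewrite /update /= h4 addn1.
  + exact: unchanged_update.
  + by case: st' => h6 h7 h8 h9; split.
  + apply: (search_inv_next inv'); first exact: (search_progress conn inv' lt).
    by move=> y; apply: cl; exact: ltn_ord.
Qed.

Lemma search_correct :
  runs n search s0 (fun s => exists o par,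
    [/\ s 4 0 = n, unchanged [:: 4; 5; 6; 7; 8; 9] s0 s, search_state s o par &
        search_inv v0 n o par]).
Proof.
have [i0 _ _ _ i8] := ini.
do 3 (apply: runs_seq; apply: runs_write).
apply: (@runs_for _ _ _ search_loop).
(* No write puts the root into array 6: its cell 0 and all of array 7 still hold 0, which is the
   rank of [v0]. *)
- exists [:: v0], (fun _ => v0); split=> //.
  + by do 3 (apply: unchanged_update => //).
  + rewrite /update /=; split=> //=.
    * by case=> //= _; rewrite i8 // rank0.
    * by move=> v; rewrite i8 // rank0.
    * by move=> v; rewrite inE -(rk_eq v v0) rank0; case: eqP => // _; rewrite i8.
  + exact: search_inv0.
- move=> i s lt inv; split; last exact: search_body_correct.
  by case: inv => o [par [/= -> fr _ _]]; rewrite fr // i0; lia.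
- move=> s inv; split=> //; case: inv => o [par [/= -> fr _ _]].
  by rewrite fr // i0 subnn.
Qed.

End Search.

(** One loop serves both cases: for [p = u] the representatives stay and the class receives its
    label; for [p] the parent of [u] the two classes are merged. *)
Lemma merge_inner_correct s (u p : G) (rep : G -> G) k :
  s 0 0 = n -> s 5 0 = 0 -> s 14 0 = rk u -> s 15 0 = rk p -> s 13 0 = k ->
  (forall v, s 11 (rk v) = rk (rep v)) ->
  runs n (While (Defs.Sub (cell 0) (cell 5)) merge_inner) s (fun s' =>
    [/\ unchanged [:: 3; 5; 11] s s',
        forall v, s' 11 (rk v) = rk (if rep v == u then p else rep v) &
        forall v, s' 3 (rk v) = if rep v == u then k else s 3 (rk v)]).
Proof.
move=> h0 h5 h14 h15 h13 h11.
pose I j (s' : store) := [/\ s' 5 0 = j, unchanged [:: 3; 5; 11] s s',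
  forall v, s' 11 (rk v) = rk (if (rk v < j) && (rep v == u) then p else rep v) &
  forall v, s' 3 (rk v) = if (rk v < j) && (rep v == u) then k else s 3 (rk v)].
apply: (@runs_for _ _ _ I); first by split.
- move=> j s' ltj [i5 fr i11 i3]; have i0 : s' 0 0 = n by rewrite fr.
  split; first by rewrite /= i0 i5; lia.
  have [w rw] := rk_surj ltj; rewrite -{j}rw in ltj i5 i11 i3 *.
  have lt (v : G) : (rk v < (rk w).+1) = (rk v == rk w) || (rk v < rk w) by rewrite ltnS leq_eqVlt.
  apply: runs_seq; apply: runs_if => /=; rewrite i5 i11 ltnn /= fr // h14.
  + move=> ne; have nw : rep w == u = false by rewrite -rk_eq; apply/negP=> /eqP E; move: ne; rewrite E; lia.
    apply: runs_skip; apply: runs_write; split.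
    * by rewrite /update /= i5 addn1.
    * exact: unchanged_update.
    * by move=> v; rewrite /update /= i11 lt; case: (eqVneq (rk v) (rk w)) => [/rk_inj->|_ //]; rewrite nw !andbF.
    * by move=> v; rewrite /update /= i3 lt; case: (eqVneq (rk v) (rk w)) => [/rk_inj->|_ //]; rewrite nw !andbF.
  + move=> E0; have Ew : rep w = u by apply: rk_inj; apply/eqP; rewrite eqn_leq -!subn_eq0 -addn_eq0 E0.
    apply: runs_seq; do 3 apply: runs_write; rewrite /update /=; split.
    * by rewrite i5 addn1.
    * by do 3 (apply: unchanged_update => //).
    * move=> v; rewrite /= i5 lt; case: eqP => [/rk_inj->|_] /=; last exact: i11.
      by rewrite Ew eqxx fr.
    * move=> v; rewrite /= i5 lt; case: eqP => [/rk_inj->|_] /=; last exact: i3.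
      by rewrite Ew eqxx fr.
- move=> s' [i5 fr i11 i3]; have i0 : s' 0 0 = n by rewrite fr.
  split; first by rewrite /= i0 i5 subnn.
  by split=> // v; rewrite ?i11 ?i3 ltn_ord.
Qed.

Section Merge.
Variables (s0 : store) (o : seq G) (par : G -> G) (B Delta m : nat).
Hypotheses (Uo : uniq o) (starto : ohead o = Some v0) (allo : forall x, x \in o)
  (parP : forall x, x != v0 -> edge x (par x) /\ index (par x) o < index x o)
  (deg : max_degree G <= Delta) (Delta2 : 2 <= Delta)
  (mB : m * (Delta - 1) < B).
Hypotheses (h0 : s0 0 0 = n) (st : search_state s0 o par)
  (h4 : s0 4 0 = n) (h11 : forall v : G, s0 11 (rk v) = rk v)
  (h12 : forall v : G, s0 12 (rk v) = 1) (h13 : s0 13 0 = 0).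
Let L := [:: 3; 4; 5; 11; 12; 13; 14; 15; 16].

Let merge_loop t (s : store) := exists rep lab k,
  [/\ merge_inv v0 o par B m t rep lab k,
      s 4 0 = t /\ s 13 0 = k,
      forall v, s 11 (rk v) = rk (rep v) /\ s 3 (rk v) = lab v,
      forall v, index v o < t -> s 12 (rk v) = #|[set w | rep w == v]| &
      unchanged L s0 s].

Lemma merge_body_correct t s : t < n -> merge_loop t.+1 s ->
  runs n (merge_body B m) s (merge_loop t).
Proof.
case: st => st6 st7 _ _.
move=> lt [rep [lab [k [inv [i4 i13] i11 i12 fr]]]].
have so : size o = n by exact: search_size.
have [u ut] : exists u, index u o = t.
  by exists (nth v0 o t); rewrite index_uniq ?so.
have s6 : s 6 t = rk u by rewrite fr // st6 ?so // -ut nth_index.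
have s7 : s 7 (rk u) = rk (par u) by rewrite fr.
have s00 : s 0 0 = n by rewrite fr.
have su : s 12 (rk u) = #|[set w | rep w == u]| by rewrite i12 ?ut.
(* The last disjunct uses the stored number instead of a class size, because for [t = 0] the current
   vertex is the root and [par] gives no genuine parent. *)
pose cut := [|| t == 0, m < #|[set w | rep w == u]| |
  B < #|[set w | rep w == u]| + s 12 (rk (par u))].
pose x := if cut then u else par u.
pose s1 := update (update s 4 0 t) 14 0 (rk u).
apply: runs_seq; apply: runs_write; apply: runs_seq; apply: runs_write.
have -> : update (update s 4 (eval s (Lit 0)) (eval s (Defs.Sub (cell 4) (Lit 1)))) 14
   (eval (update s 4 (eval s (Lit 0)) (eval s (Defs.Sub (cell 4) (Lit 1)))) (Lit 0))
   (eval (update s 4 (eval s (Lit 0)) (eval s (Defs.Sub (cell 4) (Lit 1)))) (Read 6 (cell 4))) = s1.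
  by rewrite /s1 /= i4 subn1 /= /update /= s6.
apply: runs_seq.
(* The state after the conditional, stated for both branches at once so that the rest of the body is
   verified only once. *)
pose mid (s2 : store) := [/\ unchanged [:: 12; 15; 16] s1 s2,
  s2 15 0 = rk x, s2 16 0 = cut &
  forall v, s2 12 (rk v) = if ~~ cut && (v == par u) then s 12 (rk v) + s 12 (rk u) else s 12 (rk v)].
suff H s2 : mid s2 -> runs n (Seq (assign 5 (Lit 0))
      (Seq (While (Defs.Sub (cell 0) (cell 5)) merge_inner)
           (assign 13 (Add (cell 13) (cell 16))))) s2 (merge_loop t).
  have s1E : [/\ s1 14 0 = rk u, s1 4 0 = t, s1 7 = s 7 & s1 12 = s 12] by [].
  have [e14 e4 e7 e12] := s1E.
  apply: runs_if; rewrite /= e14 e4 e7 e12 s7 => test.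
    have cutT : cut.
      by move: test; rewrite /cut su; case: eqP => //=; lia.
    apply: runs_seq; do 2 apply: runs_write; apply: H; split=> //.
    + by do 2 (apply: unchanged_update => //).
    + by rewrite /update /= /x cutT.
    + by rewrite /update /= cutT.
    + by move=> v; rewrite cutT.
  have cutF : cut = false.
    by apply/negP; rewrite /cut -su; lia.
  apply: runs_seq; apply: runs_write; apply: runs_seq; do 2 apply: runs_write; apply: H; split=> //.
  + by do 3 (apply: unchanged_update => //).
  + by rewrite /update /= /x cutF.
  + by rewrite /update /= cutF.
  + by move=> v; rewrite /update /= e14 e7 e12 s7 cutF rk_eq /=; case: eqP => // ->.
case=> fr2 j15 j16 j12.
apply: runs_seq; apply: runs_write; apply: runs_seq.
have F : unchanged [:: 4; 5; 12; 14; 15; 16] s (update s2 5 0 0).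
  apply: unchanged_update => //; move=> a i aL.
  move: aL; rewrite !inE !negb_or => /and5P[a4 a5 a12 a14 /andP[a15 a16]].
  rewrite fr2 ?inE ?negb_or ?a12 ?a15 // /s1 /update.
  by rewrite (negPf a4) (negPf a14).
apply: (runs_weaken (@merge_inner_correct _ u x rep k _ _ _ _ _ _)) => //.
- by rewrite F.
- by rewrite /update /= fr2.
- by rewrite F.
- by move=> v; rewrite F //; have [] := i11 v.
move=> s3 [fr3 k11 k3]; apply: runs_write => /=.
have lab3 v : s3 3 (rk v) = if rep v == u then k else lab v.
  by rewrite k3 F //; have [_ ->] := i11 v.
have frL : unchanged L s0 s3.
  apply: unchanged_trans fr _; apply: (@unchanged_trans _ _ (update s2 5 0 0)).
    by apply: unchanged_sub F => a; rewrite !inE; do 5 (case/orP => [/eqP-> //|]); move/eqP->.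
  by apply: unchanged_sub fr3 => a; rewrite !inE; do 2 (case/orP => [/eqP-> //|]); move/eqP->.
have n13 : s3 13 0 = k by rewrite fr3 // F.
have n16 : s3 16 0 = cut by rewrite fr3.
have n4 : s3 4 0 = t by rewrite fr3 // /update /= fr2.
have n12 v : s3 12 (rk v) = s2 12 (rk v) by rewrite fr3.
case cutE : cut.
  exists rep, (fun v => if rep v == u then k else lab v), k.+1; split.
  - apply: (@merge_inv_cut G v0 o par B Delta m) => //.
    move: cutE; rewrite /cut => /or3P[/eqP|c|c]; [by left|by right; left|].
    have [t0|tn] := eqVneq t 0; [by left | right; right].
    rewrite -(i12 (par u)) //; apply: leqW; rewrite -ut; have [] // := parP (x := u).
    by apply: contraNneq tn => E; rewrite -ut E; case: (o) starto => //= y o' [->]; rewrite eqxx.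
  - by rewrite /update /= n4 n13 n16 cutE addn1.
  - move=> v; rewrite /update /= k11 lab3 /x cutE; split=> //.
    by case: eqP => [->|].
  - by move=> v lv; rewrite /update /= n12 j12 cutE /= i12 // leqW.
  - exact: unchanged_update.
move/negbT: cutE (cutE); rewrite {1}/cut !negb_or -!leqNgt => /and3P[/eqP tn c1 c2] cutE.
have uv : u != v0.
  by apply/eqP => E; case: tn; rewrite -ut E; case: (o) starto => //= y o' [->]; rewrite eqxx.
have [eu iu] := parP uv; rewrite ut in iu.
have sp : s 12 (rk (par u)) = #|[set w | rep w == par u]| by rewrite i12 // leqW.
rewrite sp in c2.
exists (fun v => if rep v == u then par u else rep v), (fun v => if rep v == u then k else lab v), k; split.
- by apply: (@merge_inv_merge G v0 o par B Delta m).
- by rewrite /update /= n4 n13 n16 cutE addn0.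
- by move=> v; rewrite /update /= k11 lab3 /x cutE.
- move=> v lv; rewrite /update /= n12 j12 cutE /=.
  have vu : v != u by apply: contraTneq lv => ->; rewrite ut ltnn.
  case: eqP => [->|/eqP vp].
    rewrite sp su -cardsUI (_ : _ :&: _ = set0) ?cards0 ?addn0.
      apply: eq_card => w; rewrite !inE.
      by case: (rep w == u); rewrite ?eqxx ?orbT ?orbF.
    apply/setP=> w; rewrite !inE; apply/negP=> /andP[/eqP-> /eqP E].
    by rewrite E ut ltnn in iu.
  rewrite i12 ?leqW //; apply: eq_card => w; rewrite !inE.
  case: (eqVneq (rep w) u) => // ->.
  by rewrite eq_sym (negPf vu) eq_sym (negPf vp).
- exact: unchanged_update.
Qed.

Lemma merge_correct :
  runs n (While (cell 4) (merge_body B m)) s0 (merge_loop 0).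
Proof.
apply: (@runs_for _ _ _ (fun i => merge_loop (n - i))).
- rewrite subn0; exists id, (fun v => s0 3 (rk v)), 0; split=> //.
    exact: (@merge_inv0 G v0 o par B Delta m).
  by move=> v _; rewrite h12 (_ : [set w | w == v] = [set v]) ?cards1 //; apply/setP=> w; rewrite !inE.
- move=> i s lt; have -> : n - i = (n - i.+1).+1 by lia.
  move=> inv; split; last by apply: merge_body_correct => //; lia.
  by case: inv => rep [lab [k [_ [/= -> _] _ _ _]]].
- move=> s; rewrite subnn => inv; split=> //.
  by case: inv => rep [lab [k [_ [/= -> _] _ _ _]]].
Qed.

End Merge.

Lemma solver_correct B Delta m :
  max_degree G <= Delta -> 2 <= Delta -> m * (Delta - 1) < B ->
  runs n (solver B m) (input G q) (fun s => exists lab k,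
    [/\ forall v : G, s 3 (rk v) = lab v, forall v, lab v < k,
        forall i, connected_in [set v | lab v == i],
        forall i, #|[set v | lab v == i]| <= B &
        m.+1 * k <= m.+1 * Delta.+1 + n]).
Proof.
move=> deg D2 mB; apply: runs_seq.
apply: (runs_weaken init_correct) => s ini.
have [i0 i2 i11 i12 iz] := ini.
apply: runs_seq; apply: (runs_weaken (search_correct ini)) => s' [o [par [s4 fr st inv]]].
have so : size o = n.
  apply/eqP; rewrite eqn_leq (si_le inv) andbT -(card_uniqP (si_uniq inv)).
  exact: max_card.
have all := search_complete conn inv (esym so).
have step := @merge_correct s' o par B Delta m (si_uniq inv) (si_start inv) all.
apply: runs_weaken (step _ deg D2 mB _ st s4 _ _ _) _.
- by move=> x xv; apply: (si_par inv).
- by rewrite fr.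
- by move=> v; rewrite fr.
- by move=> v; rewrite fr.
- by rewrite fr // iz.
move=> s2 [rep [lab [k [minv _ h3 _ _]]]]; exists lab, k.
have [? ? ? ?] := merge_inv_end deg minv.
by split=> // v; have [] := h3 v.
Qed.

End Correctness.

(** * Clusters of a partition *)

(** Correctness of the program doubles as the existence proof: the labels are those left by a run,
    with the arbitrary choice [q = 0]. The empty graph is separate, as it has no root. *)
Lemma labelled_partition (G : sgraph) (B Delta m : nat) :
  connected_in [set: G] -> max_degree G <= Delta -> 2 <= Delta ->
  m * (Delta - 1) < B ->
  exists (lab : G -> nat) k, [/\ forall v, lab v < k,
    forall i, connected_in [set v | lab v == i],
    forall i, #|[set v | lab v == i]| <= B & m.+1 * k <= m.+1 * Delta.+1 + #|G|].
Proof.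
move=> conn deg D2 mB; have [n0|] := posnP #|G|.
  have none (x : G) : False by have := fintype0 x; rewrite n0 => /(_ erefl).
  exists (fun _ => 0), 0; split=> [v|i x|i|]; [by case: (none v)|by case: (none x)| |by rewrite muln0].
  by rewrite (_ : [set _ | _] = set0) ?cards0 //; apply/setP=> x; case: (none x).
case/rk_surj=> v0 r0.
have [t [s [_ _ [lab [k [_ H1 H2 H3 H4]]]]]] := solver_correct 0 r0 conn deg D2 mB.
by exists lab, k.
Qed.

Lemma partition_of_labels (T : finType) (W : {set T}) (lab : {x : T | x \in W} -> nat)
    k (good : {set T} -> Prop) :
  (forall x, lab x < k) -> (forall i, good (val @: [set x | lab x == i])) ->
  exists P, [/\ partition P W, {in P, forall A, good A} & #|P| <= k].
Proof.
move=> labk goodl.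
pose Lab x := if insub x is Some y then lab y else 0.
have fib i : [set x in W | Lab x == i] = val @: [set x | lab x == i].
  apply/setP=> x; rewrite inE; apply/andP/imsetP.
    case=> xW; rewrite /Lab insubT => E.
    by exists (Sub x xW); rewrite ?inE.
  by case=> y; rewrite inE => li ->; rewrite /Lab valK li (valP y).
exists (preim_partition Lab W); split; first exact: preim_partitionP.
  move=> A /imsetP[x xW ->].
  suff -> : [set y in W | Lab x == Lab y] = [set y in W | Lab y == Lab x] by rewrite fib.
  by apply/setP=> y; rewrite !inE [Lab x == _]eq_sym.
rewrite -[leqRHS]card_ord -cardsT.
apply: leq_trans (leq_imset_card (fun i : 'I_k => [set x in W | Lab x == i]) _).
apply: subset_leq_card; apply/subsetP=> A /imsetP[x xW ->].
have ltk : Lab x < k by rewrite /Lab insubT.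
apply/imsetP; exists (Ordinal ltk); rewrite ?inE //.
by apply/setP=> y; rewrite !inE [Lab x == _]eq_sym.
Qed.

Section Induced.
Variables (G : sgraph) (W : {set G}).

Definition induced_edge : rel {x : G | x \in W} := fun x y => edge (val x) (val y).

Lemma induced_sym : symmetric induced_edge.
Proof. by move=> x y; exact: edge_sym. Qed.

Lemma induced_irrefl : irreflexive induced_edge.
Proof. by move=> x; exact: edge_irrefl. Qed.

Definition induced : sgraph := SGraph induced_sym induced_irrefl.

Lemma induced_connected : connected_in W -> connected_in [set: induced].
Proof.
move=> conn x y _ _; pose h (z : G) : induced := insubd x z.
have hK (z : induced) : h (val z) = z by exact: valKd.
rewrite -(hK x) -(hK y); move: (conn _ _ (valP x) (valP y)).
apply: homo_connect => u v /= /andP[/andP[uW vW] uv].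
by apply: connect1; rewrite /= !inE /= /induced_edge /h !insubdK.
Qed.

Lemma induced_max_degree : max_degree induced <= max_degree G.
Proof.
apply/bigmax_leqP=> x _; apply: leq_trans (leq_bigmax (val x)).
rewrite /degree -(card_imset _ val_inj); apply: subset_leq_card.
by apply/subsetP=> z /imsetP[y + ->]; rewrite !inE.
Qed.

Lemma induced_connected_image (A : {set induced}) :
  connected_in A -> connected_in ([set val x | x in A] : {set G}).
Proof.
move=> conn _ _ /imsetP[x xA ->] /imsetP[y yA ->]; move: (conn x y xA yA).
apply: (homo_connect (h := val)) => u v /= /andP[/andP[uA vA] uv].
by apply: connect1; rewrite /= !imset_f.
Qed.

End Induced.

Lemma repartition (G : sgraph) (W : {set G}) (B Delta m : nat) :
  connected_in W -> max_degree G <= Delta -> 2 <= Delta -> m * (Delta - 1) < B ->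
  exists P, [/\ partition P W, {in P, forall A, connected_in A /\ #|A| <= B} &
    m.+1 * #|P| <= m.+1 * Delta.+1 + #|W|].
Proof.
move=> conn deg D2 mB.
have [lab [k [labk C S N]]] := labelled_partition (induced_connected conn)
  (leq_trans (induced_max_degree W) deg) D2 mB.
have [|P [PW Pg Pk]] := partition_of_labels (good := fun A => connected_in A /\ #|A| <= B) labk.
  move=> i; split; first exact: induced_connected_image (C i).
  by rewrite card_imset //; exact: val_inj.
exists P; split=> //; apply: leq_trans (_ : m.+1 * k <= _); first by rewrite leq_mul2l Pk orbT.
by apply: leq_trans N _; rewrite leq_add2l card_sig; apply: eq_leq; apply: eq_card.
Qed.

Section Quotient.
Variables (G : sgraph) (P : {set {set G}}).
Hypothesis partP : partition P [set: G].

Definition quotient_edge : rel {A : {set G} | A \in P} := fun A B =>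
  (A != B) && [exists x in val A, exists y in val B, edge x y].

Lemma quotient_sym : symmetric quotient_edge.
Proof.
have half A B : quotient_edge A B -> quotient_edge B A.
  case/andP=> ne /exists_inP[x xA /exists_inP[y yB xy]].
  rewrite /quotient_edge eq_sym ne; apply/exists_inP; exists y => //.
  by apply/exists_inP; exists x; rewrite // edge_sym.
by move=> A B; apply/idP/idP; exact: half.
Qed.

Lemma quotient_irrefl : irreflexive quotient_edge.
Proof. by move=> A; rewrite /quotient_edge eqxx. Qed.

Definition quotient : sgraph := SGraph quotient_sym quotient_irrefl.

Lemma mem_partition x : exists A : quotient, x \in val A.
Proof.
have xP : x \in cover P by rewrite (cover_partition partP).
by exists (Sub (pblock P x) (pblock_mem xP)); rewrite /= mem_pblock.
Qed.

Lemma quotient_block (A : quotient) x : x \in val A -> pblock P x = val A.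
Proof. by apply: def_pblock (valP A); case/and3P: partP. Qed.

Lemma quotient_pick (A : quotient) : exists x, x \in val A.
Proof.
apply/set0Pn; apply/eqP=> E; case/and3P: partP => _ _ /negP[].
by rewrite -E; exact: valP.
Qed.

Lemma quotient_connected : connected_in [set: G] -> connected_in [set: quotient].
Proof.
move=> conn A B _ _; have [x xA] := quotient_pick A; have [y yB] := quotient_pick B.
pose h z : quotient := insubd A (pblock P z).
have hE (C : quotient) z : z \in val C -> h z = C.
  by move=> zC; rewrite /h (quotient_block zC) valKd.
rewrite -(hE A x xA) -(hE B y yB); move: (conn x y (in_setT _) (in_setT _)).
apply: homo_connect => u v /= /andP[_ uv].
have [U uU] := mem_partition u; have [V vV] := mem_partition v.
rewrite (hE U) // (hE V) //; have [->|ne] := eqVneq U V; first exact: connect0.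
apply: connect1; rewrite /= !inE /= /quotient_edge ne.
by apply/exists_inP; exists u => //; apply/exists_inP; exists v.
Qed.

(** A block has at most [B] vertices, each with at most [max_degree G] neighbours, and every
    adjacent block contains one of these neighbours. *)
Lemma quotient_max_degree B : {in P, forall A : {set G}, #|A| <= B} ->
  max_degree quotient <= max_degree G * B.
Proof.
move=> size; apply/bigmax_leqP=> A _.
rewrite /degree -(card_imset _ val_inj).
pose N := \bigcup_(x in val A) [set y | edge x y].
apply: leq_trans (_ : #|pblock P @: N| <= _).
  apply: subset_leq_card; apply/subsetP=> z /imsetP[C + ->]; rewrite inE.
  case/andP=> _ /exists_inP[x xA /exists_inP[y yC xy]].
  apply/imsetP; exists y; last by rewrite (quotient_block yC).
  by apply/bigcupP; exists x; rewrite ?inE.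
apply: leq_trans (leq_imset_card _ _) _.
apply: leq_trans (_ : \sum_(x in val A) degree x <= _).
  rewrite /N; elim/big_ind2: _ => [|a b X Y la lb|x _]; rewrite ?cards0 //.
  by apply: leq_trans (leq_add la lb); rewrite cardsU leq_subr.
apply: leq_trans (_ : \sum_(x in val A) max_degree G <= _).
  by apply: leq_sum => x _; exact: leq_bigmax.
by rewrite sum_nat_const mulnC leq_mul2l size ?orbT //; exact: valP.
Qed.

(** Choosing a vertex [r A] in each block turns an edge of the quotient into a path inside two
    adjacent blocks. *)
Lemma quotient_connected_cover (C : {set quotient}) :
  {in P, forall A, connected_in A} -> connected_in C ->
  connected_in (cover ([set val A | A in C])).
Proof.
move=> conn connC x y; rewrite cover_imset.
case/bigcupP=> A AC xA /bigcupP[A' AC' yA'].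
set W := \bigcup_(_ in _) _.
have inside (X : quotient) u v : X \in C -> u \in val X -> v \in val X ->
    connect [rel u v in W | edge u v] u v.
  move=> XC uX vX; apply: connected_in_subset (conn _ (valP X) u v uX vX).
  exact: (bigcup_sup X).
have [r rP] := fin_all_exists quotient_pick.
have inW (X : quotient) u : X \in C -> u \in val X -> u \in W.
  by move=> XC uX; apply/bigcupP; exists X.
apply: connect_trans (inside A x (r A) AC xA (rP A)) _.
apply: connect_trans (inside A' (r A') y AC' (rP A') yA').
move: (connC A A' AC AC'); apply: homo_connect => X Y /= /andP[/andP[XC YC]].
case/andP=> _ /exists_inP[u uX /exists_inP[v vY uv]].
apply: connect_trans (inside X (r X) u XC (rP X) uX) _.
apply: connect_trans (inside Y v (r Y) YC vY (rP Y)).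
by apply: connect1; rewrite /= (inW X) // (inW Y).
Qed.

End Quotient.

(** This is the labelling result for the quotient, with degree bound [Delta * B], with [M] in the
    role of [m], and with the least class bound its hypothesis allows. *)
Lemma clustering (G : sgraph) (P : {set {set G}}) (B Delta M : nat) :
  connected_in [set: G] -> max_degree G <= Delta -> 2 <= Delta -> 2 <= B ->
  bounded_contiguous_partition B P ->
  exists CC : {set {set {set G}}}, [/\ partition CC P,
    {in CC, forall C, connected_in (cover C) /\ #|C| <= (M * (Delta * B - 1)).+1} &
    M.+1 * #|CC| <= M.+1 * (Delta * B).+1 + #|P|].
Proof.
move=> conn deg D2 B2 [partP blocks].
have [lab [k [labk C S N]]] := labelled_partition (Delta := Delta * B)
  (quotient_connected partP conn)
  (leq_trans (quotient_max_degree partP (fun A AP => proj2 (blocks A AP)))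
     (leq_mul deg (leqnn B)))
  (leq_trans D2 (leq_pmulr _ (ltnW B2))) (ltnSn (M * (Delta * B - 1))).
have [|CC [CP Cg Ck]] := partition_of_labels (good := fun C : {set {set G}} =>
    connected_in (cover C) /\ #|C| <= (M * (Delta * B - 1)).+1) labk.
  move=> i; split; last by rewrite card_imset; [exact: S | exact: val_inj].
  by apply: quotient_connected_cover (C i) => // A AP; have [] := blocks A AP.
exists CC; split=> //; apply: leq_trans (_ : M.+1 * k <= _); first by rewrite leq_mul2l Ck orbT.
by apply: leq_trans N _; rewrite leq_add2l card_sig; apply: eq_leq; apply: eq_card.
Qed.

(** * Local changes of a partition *)

Section Replacement.
Variables (G : sgraph) (B : nat) (P C Q : {set {set G}}).
Hypotheses (bP : bounded_contiguous_partition B P) (CP : C \subset P)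
  (partQ : partition Q (cover C))
  (bQ : {in Q, forall A, connected_in A /\ #|A| <= B}).
Let PQ := (P :\: C) :|: Q.

Lemma replacement_partition : bounded_contiguous_partition B PQ.
Proof.
have [partP blocks] := bP; have [/and3P[/eqP covP trP n0P] /and3P[/eqP covQ trQ n0Q]] := (partP, partQ).
split; last by move=> A; rewrite !inE => /orP[/andP[_ /blocks]|/bQ].
apply/and3P; split.
- apply/eqP/setP=> x; rewrite inE; apply/bigcupP.
  have xP : x \in cover P by rewrite covP.
  have [xC|xC] := boolP (pblock P x \in C).
    have : x \in cover Q by rewrite covQ; apply/bigcupP; exists (pblock P x); rewrite ?mem_pblock.
    by case/bigcupP=> A AQ xA; exists A; rewrite // inE AQ orbT.
  by exists (pblock P x); rewrite ?mem_pblock // !inE xC pblock_mem.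
- apply: trivIsetU => //; first by apply: trivIsetS trP; exact: subsetDl.
  rewrite covQ; apply/pred0P=> x; apply/negP=> /andP[/bigcupP[A + xA] /bigcupP[A' AC xA']].
  rewrite inE => /andP[AC' AP]; case/negP: AC'.
  by rewrite -(def_pblock trP AP xA) (def_pblock trP _ xA') // (subsetP CP).
- by rewrite !inE negb_or (negPf n0Q) negb_and n0P orbT.
Qed.

Lemma replacement_agree : agree_except (cover C) P PQ.
Proof.
have [partP _] := bP; have [partPQ _] := replacement_partition.
have [/and3P[/eqP covP trP _] /and3P[_ trPQ _]] := (partP, partPQ).
(* Each class is labelled by its own rank among all vertex sets, so a class common to both
   partitions has the same label in both. *)
exists (fun A => enum_rank A : nat), (fun A => enum_rank A : nat).
split; try by move=> A A' _ _ /val_inj/enum_rank_inj.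
move=> v vC; have vP : v \in cover P by rewrite covP.
congr (nat_of_ord (enum_rank _)); apply/esym; apply: def_pblock => //; last by rewrite mem_pblock.
rewrite !inE pblock_mem // andbT; apply/orP; left.
by apply: contra vC => AC; apply/bigcupP; exists (pblock P v); rewrite ?mem_pblock.
Qed.

Lemma card_replacement : #|Q| < #|C| -> #|PQ| < #|P|.
Proof.
move=> lt; apply: leq_ltn_trans (leq_addr #|(P :\: C) :&: Q| _) _.
rewrite cardsUI cardsD (setIidPr CP).
by rewrite -[ltnRHS](subnK (subset_leq_card CP)) ltn_add2l.
Qed.

End Replacement.

Section Improvements.
Variables (G : sgraph) (B Delta m M : nat) (P : {set {set G}}).
Hypotheses (conn : connected_in [set: G]) (deg : max_degree G <= Delta)
  (Delta2 : 2 <= Delta) (B2 : 2 <= B) (mB : m * (Delta - 1) < B)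
  (bP : bounded_contiguous_partition B P).
Let B' := (M * (Delta * B - 1)).+1.

Definition improvement (Q : {set {set G}}) : Prop :=
  [/\ bounded_contiguous_partition B Q, #|Q| < #|P| &
    exists W : {set G}, [/\ connected_in W, #|W| <= B' * B & agree_except W P Q]].

(** The number [c] counts clusters. In the sum over clusters, one outside [big] satisfies the
    reverse of the inequality defining [big], and one in [big] contributes at most [m.+1 * B']. *)
Lemma many_improvements : exists (Omega : {set {set {set G}}}) c,
  [/\ {in Omega, forall Q, improvement Q},
      m.+1 * #|P| <= #|G| + c * (m.+1 * Delta.+1) + #|Omega| * (m.+1 * B') &
      M.+1 * c <= M.+1 * (Delta * B).+1 + #|P|].
Proof.
have [CC [partCC goodCC cardCC]] := clustering M conn deg Delta2 B2 bP.
have [/and3P[/eqP covCC trCC _] [partP blocks]] := (partCC, bP).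
have CCP C : C \in CC -> C \subset P.
  by move=> hC; apply/subsetP=> A AC; rewrite -covCC; apply/bigcupP; exists C.
(* The inequality under which the bound of [repartition] on [cover C] falls below [#|C|] classes. *)
pose big := [set C in CC | m.+1 * Delta.+1 + #|cover C| < m.+1 * #|C|].
have repl C : exists Q, C \in big -> improvement Q /\ P :\: C \subset Q.
  have [|no] := boolP (C \in big); last by exists set0.
  rewrite inE => /andP[hC lt]; have [cC sC] := goodCC C hC.
  have [Q [partQ bQ cQ]] := repartition cC deg Delta2 mB.
  have ltQ : #|Q| < #|C|.
    by rewrite -(ltn_pmul2l (ltn0Sn m)); exact: leq_ltn_trans cQ lt.
  exists ((P :\: C) :|: Q) => _; split; last exact: subsetUl.
  split; first exact: (replacement_partition bP (CCP C hC) partQ bQ).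
    exact: (card_replacement (CCP C hC) ltQ).
  exists (cover C); split=> //; last exact: (replacement_agree bP (CCP C hC) partQ bQ).
  apply: leq_trans (leq_card_cover C) _.
  apply: leq_trans (_ : \sum_(A in C) B <= _).
    by apply: leq_sum => A AC; have [] := blocks A (subsetP (CCP C hC) A AC).
  by rewrite sum_nat_const leq_mul2r sC orbT.
have [f fP] := fin_all_exists repl.
(* Changes at two disjoint clusters that gave the same result would keep every block of [P],
   contradicting the smaller number of classes. *)
have f_inj : {in big &, injective f}.
  move=> C C' hC hC' E; apply/eqP; apply: contraT => ne.
  have [[_ lt _] sub] := fP C hC; have [_ sub'] := fP C' hC'.
  have : P \subset f C.
    apply/subsetP=> A AP; have [AC|AC] := boolP (A \in C); last first.
      by apply: (subsetP sub); rewrite inE AC AP.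
    rewrite E; apply: (subsetP sub'); rewrite inE AP andbT.
    move: hC hC'; rewrite !inE => /andP[hC _] /andP[hC' _].
    by have /disjointFr-> := trivIsetP trCC C C' hC hC' ne.
  by move/subset_leq_card; rewrite leqNgt lt.
exists (f @: big), #|CC|; split=> //.
  by move=> Q /imsetP[C hC ->]; have [] := fP C hC.
rewrite card_in_imset // (card_partition partCC) -cardsT (card_partition partP).
have <- : \sum_(C in CC) \sum_(A in C) #|A| = \sum_(A in P) #|A|.
  by rewrite -[in RHS]covCC big_trivIset.
rewrite big_distrr /=.
have -> : #|big| = \sum_(C in CC) (C \in big).
  rewrite -sum1_card [RHS]big_mkcond [LHS]big_mkcond; apply: eq_bigr => C _.
  by rewrite inE; case: (C \in CC) => //=; case: ifP.
rewrite -[#|CC|]sum1_card !big_distrl -!big_split /=; apply: leq_sum => C hC.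
have := leq_card_cover C; rewrite inE hC /=; have [_] := goodCC C hC.
move: (#|cover C|) (#|C|) => a b; rewrite -/B' => h1 [h2 _].
case: ltnP => h3; last by move: h2 h3; lia.
by rewrite !mul1n; apply: leq_trans (leq_addl _ _); rewrite leq_mul2l h1 orbT.
Qed.

End Improvements.

(** * Density estimates *)

Import Order.TTheory GRing.Theory Num.Theory.
Local Open Scope ring_scope.

Lemma solver_findable (B Delta m : nat) (dom : sgraph -> nat -> Prop) :
  (2 <= Delta)%N -> (m * (Delta - 1) < B)%N ->
  (forall G q, dom G q -> [/\ connected_max_degree_le Delta G, (0 < #|G|)%N &
     (m.+1 * Delta.+1 + #|G| <= m.+1 * q)%N]) ->
  polytime_findable dom (fun G q f => bounded_contiguous_qpartition B f).
Proof.
move=> D2 mB domP; have [C HC] := time_bound_poly (solver B m).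
exists (solver B m), C, (loop_depth (solver B m)) => G q /domP[[conn deg] n_gt0 le_q].
have [v0 r0] := rk_surj n_gt0.
have [t [s [ex le_t [lab [k [out labk CL SL N]]]]]] := solver_correct q r0 conn deg D2 mB.
(* The labels below [k] become labels in ['I_q]; the remaining ones name empty pieces. *)
have kq : (k <= q)%N by rewrite -(leq_pmul2l (ltn0Sn m)) (leq_trans N).
have labq v : (lab v < q)%N by exact: leq_trans (labk v) kq.
exists t, s, (fun v => Ordinal (labq v)); split=> //; first exact: leq_trans le_t (HC _).
by move=> i; have -> : piece (fun v => Ordinal (labq v)) i = [set v | lab v == i].
Qed.

(** The product of the density and [B] is [(B - 1) / (Delta - 1)], which is at most its integer part
    plus one. *)
Lemma density_bound (R : realType) (B Delta n q : nat) (eps : R) :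
  (2 <= B)%N -> (2 <= Delta)%N -> 0 < eps ->
  (1 + eps) * n%:R / (1 / (Delta%:R - 1) * ((B%:R - 1) / B%:R) * B%:R) < q%:R ->
  (1 + eps) * n%:R < ((B - 1) %/ (Delta - 1)).+1%:R * q%:R.
Proof.
move=> B2 D2 e0; set m := (_ %/ _)%N.
have B1 : (2 : R) <= B%:R by rewrite ler_nat.
have D1 : (2 : R) <= Delta%:R by rewrite ler_nat.
have le_m : B%:R - 1 <= m.+1%:R * (Delta%:R - 1) :> R.
  rewrite -(natrB R (ltnW B2)) -(natrB R (ltnW D2)) -natrM ler_nat.
  by apply: ltnW; apply: ltn_ceil; rewrite subn_gt0.
have -> : 1 / (Delta%:R - 1) * ((B%:R - 1) / B%:R) * B%:R = (B%:R - 1) / (Delta%:R - 1) :> R.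
  by field; apply/andP; split; apply/eqP; lra.
rewrite ltr_pdivrMr; last by apply: divr_gt0; lra.
move/lt_le_trans; apply; rewrite mulrC ler_wpM2r ?ler0n //.
by rewrite ler_pdivrMr //; lra.
Qed.

Lemma archi_multiple (R : realType) (x eps : R) :
  0 < eps -> exists k : nat, x <= eps * k%:R.
Proof.
move=> eps0; exists (Num.bound (`|x| / eps)); rewrite mulrC -ler_pdivrMr //.
apply: le_trans (_ : `|x| / eps <= _); first by rewrite ler_pM2r ?invr_gt0 ?ler_norm.
by apply/ltW/archi_boundP/divr_ge0; [exact: normr_ge0 | exact: ltW].
Qed.

Theorem proposition2 (R : realType) (B Delta : nat)
    (hB : (2 <= B)%N) (hDelta : (2 <= Delta)%N) :
  partitionable (connected_max_degree_le Delta) B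
    ((1 / (Delta%:R - 1)) * ((B%:R - 1) / B%:R) : R).
Proof.
move=> eps eps0.
pose m := ((B - 1) %/ (Delta - 1))%N.
have mB : (m * (Delta - 1) < B)%N by have := leq_divM (B - 1) (Delta - 1); rewrite -/m; lia.
pose a := (m.+1 * Delta.+1)%N.
(* With [M] and [n0] chosen like this, the additive errors of the cluster inequality amount to at
   most two quarters of [eps * #|G|]. *)
have [M hM] : exists M : nat, 4 * a%:R <= eps * M%:R := archi_multiple _ eps0.
pose b := (a * (Delta * B).+1)%N.
have [n0 hn0] : exists n0 : nat, 4 * b%:R <= eps * n0%:R := archi_multiple _ eps0.
pose B' := (M * (Delta * B - 1)).+1.
pose c : R := (m.+1 * B')%:R.
have c0 : 0 < c by rewrite ltr0n.
(* A cluster has at most [B'] blocks of at most [B] vertices. The remaining half of [eps * #|G|]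
   must come from clusters in [big], each worth at most [c]. *)
exists (B' * B)%N, (eps / 2 / c); split; first by rewrite !divr_gt0.
exists n0 => admissible.
have large G q : admissible G q ->
    (1 + eps) * #|G|%:R < m.+1%:R * q%:R /\ 4 * b%:R <= eps * #|G|%:R.
  case=> _ le_n dens; split; first exact: density_bound dens.
  by apply: le_trans hn0 _; apply: ler_wpM2l; [exact: ltW | rewrite ler_nat].
split.
  apply: (solver_findable hDelta mB) => G q adm; have [d1 d2] := large G q adm.
  have ab : (a <= b)%N by rewrite leq_pmulr.
  have abR : a%:R <= b%:R :> R by rewrite ler_nat.
  have a0 : 0 < a%:R :> R by rewrite ltr0n.
  split; first by case: adm.
    by rewrite lt0n; apply/eqP=> n00; rewrite n00 mulr0 in d2; lra.
  by rewrite -(ler_nat R) natrD [in leRHS]natrM -/a; lra.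
move=> G q adm P bP cardP; have [d1 d2] := large G q adm.
have [[conn deg] _ _] := adm.
have [Omega [j [imp bound1 bound2]]] := many_improvements M conn deg hDelta hB mB bP.
exists Omega; split; last by move=> Q /imp[? lt ?]; rewrite -cardP.
have qn : (#|P| <= #|G|)%N.
  case: bP => partP _; rewrite -cardsT (card_partition partP) -sum1_card.
  apply: leq_sum => A AP; rewrite card_gt0; apply: contraTneq AP => ->.
  by case/and3P: partP.
rewrite mulrAC ler_pdivrMr //.
have h1 : m.+1%:R * q%:R <= #|G|%:R + j%:R * a%:R + #|Omega|%:R * c :> R.
  by rewrite -cardP -!natrM -!natrD ler_nat.
have h2 : M.+1%:R * (j%:R * a%:R) <= M.+1%:R * b%:R + #|G|%:R * a%:R :> R.
  rewrite -!natrM -!natrD ler_nat.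
  rewrite mulnA; apply: leq_trans (_ : (M.+1 * (Delta * B).+1 + #|P|) * a <= _)%N.
    by rewrite leq_mul2r bound2 orbT.
  by rewrite mulnDl -mulnA [(_.+1 * a)%N]mulnC leq_add2l leq_mul2r qn orbT.
have h3 : #|G|%:R * a%:R <= M.+1%:R * (eps * #|G|%:R / 4) :> R.
  have : 0 <= #|G|%:R :> R by [].
  rewrite -(natr1 M); move: hM eps0; nra.
have h4 : j%:R * a%:R <= b%:R + eps * #|G|%:R / 4 :> R.
  by rewrite -(ler_pM2l (ltr0Sn R M)) mulrDr; apply: le_trans h2 _; rewrite lerD2l.
(* By [d1] and [h1], [eps * #|G|] is less than [j * a + #|Omega| * c], and [h4] with [d2] bounds
   [j * a] by half of [eps * #|G|]. *)
lra.
Qed.
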